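(* Let $K$ be a Legendrian knot in $(\mathbb{R}^3,\xi_{st})$. Then for all $i,j\in\mathbb{Z}$, $$H_{i,j}(K)\cong H_{i,\,j-tb(K),\,j}(K),$$ where $H_{i,j}(K)$ is the Khovanov homology group (with $\mathbb{Z}_2$ coefficients) of the smooth knot underlying $K$, $H_{i,k,j}(K)$ is the Legendrian Khovanov homology of $K$ (the second index being the $k$-grading), and $tb(K)$ is the Thurston-Bennequin number of $K$.
   Context: Contact setting. $\xi_{st}=\ker(dz-y\,dx)$ on $\mathbb{R}^3$. A Legendrian knot is a smooth embedding of $\mathbb{S}^1$ in $\mathbb{R}^3$ everywhere tangent to $\xi_{st}$. The front projection $K_F$ of $K$ is its image under $(x,y,z)\mapsto(x,z)$, always taken generic: a closed curve in the $xz$-plane with no vertical tangents, smooth except for finitely many left/right cusps, and with finitely many transverse double points (crossings). At each crossing the strand of smaller slope is the over-strand. Notation. $\omega(K_F)$ is the writhe (number of right-handed, i.e. positive, crossings minus number of left-handed, i.e. negative, crossings; independent of orientation for a knot), $l(K_F)$ is the number of left-handed (negative) crossings, $c(K_F)$ is the number of cusps. The Thurston-Bennequin number is $tb(K)=\omega(K_F)-\frac{c(K_F)}{2}$. Resolutions and states. At a crossing, with the four ends called NW, NE, SW, SE, the $A$-resolution replaces the crossing by an arc joining NW to NE and a disjoint arc below it joining SW to SE, with no cusps; the $B$-resolution replaces it by an arc joining NW to SW through a new right cusp and a disjoint arc joining NE to SE through a new left cusp. A Legendrian state $s$ of $K_F$ is the result of resolving every crossing; it is a disjoint union of planar cusped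 loops. $A(s),B(s)$ are the numbers of $A$- and $B$-resolutions in $s$, $\sigma(s)=A(s)-B(s)$, and $c(s)$ is the number of cusps of $s$. An enhanced Legendrian state $S$ is a Legendrian state $s$ with a label $+$ or $-$ on each loop; $\sigma(S)=\sigma(s)$, $c(S)=c(s)$, and $\tau(S)$ is the number of $+$ labels minus the number of $-$ labels. Gradings: $$i(S)=\tfrac{\omega(K_F)-\sigma(S)}{2},\quad j(S)=\tfrac{3\omega(K_F)-\sigma(S)+2\tau(S)}{2},\quad k(S)=\tfrac{c(S)-2l(K_F)+2\tau(S)}{2}.$$ Complex. $C(K_F)$ is the $\mathbb{Z}_2$-vector space with basis the enhanced Legendrian states of $K_F$, and $C_{i,k,j}(K_F)$ is the span of those $S$ with $i(S)=i$, $k(S)=k$, $j(S)=j$. A Legendrian state $t$ is incident with $s$ if they differ in resolution at exactly one crossing, where $s$ has the $A$-resolution and $t$ the $B$-resolution. An enhanced state $T$ is incident with $S$ if $t$ is incident with $s$, $j(S)=j(T)$, $k(S)=k(T)$, and the loops common to $s$ and $t$ (those not meeting the crossing where they differ) carry the same labels. The differential is $\partial(S)=\sum_T T$ over all enhanced states $T$ incident with $S$; it maps $C_{i,k,j}(K_F)$ to $C_{i+1,k,j}(K_F)$, and $H_{i,k,j}(K)=H_{i,k,j}(K_F)=\ker(\partial|_{C_{i,k,j}(K_F)})/\partial(C_{i-1,k,j}(K_F))$, which is independent of the front projection up to isomorphism. Khovanov homology convention. $H_{i,j}(K)$ is the usual Khovanov homology over $\mathbb{Z}_2$ ($i$ homological,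 $j$ quantum grading): for any knot diagram, it is the homology of the complex spanned by the enhanced Kauffman states (smoothings with $\pm$ labels on circles), with $i=\frac{\omega-\sigma}{2}$, $j=\frac{3\omega-\sigma+2\tau}{2}$ and differential the sum over states obtained by changing one $A$-smoothing to a $B$-smoothing, preserving $j$ and the labels of unaffected circles. *)

(* Defs.v *)
From HB Require Import structures.
From mathcomp Require Import all_boot all_order all_algebra finmap.
From mathcomp Require Import generic_quotient ring_quotient.
From mathcomp Require Import all_classical all_reals all_analysis.

Set Implicit Arguments.
Unset Strict Implicit.
Unset Printing Implicit Defensive.

Import Order.TTheory GRing.Theory Num.Theory.
Import numFieldNormedType.Exports.

Local Open Scope classical_set_scope.
Local Open Scope ring_scope.

(** * Subquotients of vector spaces *)

(* Z / (B :&: Z); this is Z / B when B <= Z. *)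
Definition subquotient (F : fieldType) (V : vectType F) (Z B : {vspace V}) :=
  Quotient.quot (linfun (vsval : subvs_of Z -> V) @^-1: B)%VS.

Section SubquotientLmodule.
Variables (F : fieldType) (V : vectType F) (Z B : {vspace V}).
Local Notation Q := (subquotient Z B).
Local Notation I := (linfun (vsval : subvs_of Z -> V) @^-1: B)%VS.

HB.instance Definition _ := GRing.Zmodule.on Q.

Local Notation pi := (\pi_(Quotient.quot I)%qT : subvs_of Z -> Q).

Definition subquotient_scale (a : F) (u : Q) : Q :=
  pi (a *: (repr (u : Quotient.quot I) : subvs_of Z)).

Lemma subquotient_scale_pi a v : subquotient_scale a (pi v) = pi (a *: v).
Proof.
apply/eqP; rewrite -Quotient.idealrBE -scalerBr rpredZ //.
by rewrite Quotient.idealrBE reprK.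
Qed.

Lemma subquotient_piD u v : pi (u + v) = pi u + pi v.
Proof. exact: (raddfD \pi_(Quotient.quot I)%qT). Qed.

Lemma subquotient_pi_surj (u : Q) : exists v, u = pi v.
Proof. by exists (repr (u : Quotient.quot I)); rewrite reprK. Qed.

Fact subquotient_scaleA a b u :
  subquotient_scale a (subquotient_scale b u) = subquotient_scale (a * b) u.
Proof.
by have [v ->] := subquotient_pi_surj u; rewrite !subquotient_scale_pi scalerA.
Qed.

Fact subquotient_scale1 : left_id 1 subquotient_scale.
Proof.
move=> u; have [v ->] := subquotient_pi_surj u.
by rewrite subquotient_scale_pi scale1r.
Qed.

Fact subquotient_scaleDr : right_distributive subquotient_scale +%R.
Proof.
move=> a u v; have [u' ->] := subquotient_pi_surj u.
have [v' ->] := subquotient_pi_surj v.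
by rewrite -subquotient_piD !subquotient_scale_pi scalerDr subquotient_piD.
Qed.

Fact subquotient_scaleDl u : {morph subquotient_scale^~ u : a b / a + b}.
Proof.
move=> a b; have [v ->] := subquotient_pi_surj u.
by rewrite !subquotient_scale_pi scalerDl subquotient_piD.
Qed.

HB.instance Definition _ := GRing.Zmodule_isLmodule.Build F Q
  subquotient_scaleA subquotient_scale1 subquotient_scaleDr
  subquotient_scaleDl.

End SubquotientLmodule.

Definition lmod_isomorphic (F : fieldType) (U V : lmodType F) : Prop :=
  exists f : {linear U -> V}, bijective f.

(** * The Z_2-complex spanned by a finite set E, with d S = \sum_(T | inc S T) T *)

Section SpannedComplex.
Variables (E : finType) (inc : rel E).

Definition chain := {ffun E -> ('F_2)^o}.

Definition gen (S : E) : chain := [ffun T => (T == S)%:R].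

Definition boundary_fun (v : chain) : chain :=
  \sum_S v S *: \sum_(T | inc S T) gen T.

Fact boundary_fun_is_linear : linear boundary_fun.
Proof.
move=> a u v; rewrite /boundary_fun scaler_sumr -big_split /=.
by apply: eq_bigr => S _; rewrite !ffunE scalerDl scalerA.
Qed.

HB.instance Definition _ := GRing.isLinear.Build 'F_2 chain chain _
  boundary_fun boundary_fun_is_linear.

Definition boundary : 'End(chain) := linfun boundary_fun.

Definition span_gen (P : pred E) : {vspace chain} := <<[seq gen e | e in P]>>%VS.

(* Homology at the part of the complex spanned by P, the incoming differential
   being that of the part spanned by P'. *)
Definition homology (P' P : pred E) :=
  subquotient (lker boundary :&: span_gen P)%VS (boundary @: span_gen P')%VS.

End SpannedComplex.

(** * Knots in R^3 *)

Definition smooth (R : realType) (f : R -> R) : Prop :=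
  forall n t, derivable (derive1n n f) t 1.

(* The circle is R / Z, with fundamental domain [0, 1[. *)
Record knot (R : realType) := Knot {
  kx : R -> R;
  ky : R -> R;
  kz : R -> R;
  smooth_kx : smooth kx;
  smooth_ky : smooth ky;
  smooth_kz : smooth kz;
  periodic_kx : forall t, kx (t + 1) = kx t;
  periodic_ky : forall t, ky (t + 1) = ky t;
  periodic_kz : forall t, kz (t + 1) = kz t;
  knot_immersion : forall t,
    (derive1 kx t, derive1 ky t, derive1 kz t) <> (0, 0, 0);
  knot_injective :
    {in `[0, 1[%R &, injective (fun t => (kx t, ky t, kz t))}
}.

Definition legendrian (R : realType) (K : knot R) : Prop :=
  forall t, derive1 (kz K) t = ky K t * derive1 (kx K) t.

(** * The diagram of a knot in the xz-plane *)

(* The plane is drawn with x to the right and z upwards, and is seen from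
   y = -oo.  The projection is a diagram when its double points are finitely
   many and transverse and it has no triple points.  It may have cusps: these are
   corners of the plane curve, and rounding them affects neither the crossings
   nor the arcs. *)

Section Diagram.
Variables (R : realType) (K : knot R).

Definition proj (t : R) : R * R := (kx K t, kz K t).

Definition velocity (t : R) : R * R := (derive1 (kx K) t, derive1 (kz K) t).

Definition det2 (u v : R * R) : R := u.1 * v.2 - u.2 * v.1.

Definition double_points : set (R * R) :=
  [set p | [/\ 0 <= p.1, p.1 < p.2, p.2 < 1 & proj p.1 = proj p.2]].

(* [fset_set] is the empty set on infinite sets. *)
Definition crossing : finType := fset_set double_points.

Definition over (c : crossing) : R :=
  let: (s, t) := val c in if ky K s < ky K t then s else t.

Definition under (c : crossing) : R :=
  let: (s, t) := val c in if ky K s < ky K t then t else s.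

Definition positive_crossing (c : crossing) : bool :=
  0 < det2 (velocity (over c)) (velocity (under c)).

Definition negative_crossing (c : crossing) : bool :=
  det2 (velocity (over c)) (velocity (under c)) < 0.

Definition left_number : nat := #|negative_crossing|.

Definition writhe : int := #|positive_crossing|%:Z - #|negative_crossing|%:Z.

(* An end (t, b) at a crossing: the part of the strand through the parameter t
   that leaves it (b = true) or arrives there (b = false). *)
Definition strand_end : Type := R * bool.

Definition end_dir (e : strand_end) : R * R :=
  if e.2 then velocity e.1 else - velocity e.1.

Definition ends (c : crossing) : seq strand_end :=
  [:: (over c, true); (over c, false); (under c, true); (under c, false)].

(* The circle is cut at the crossing parameters, and also at the base point 0 so
   that there is a cut even when there are no crossings.  An arc is named after
   the cut at which it starts, and it stops at the next cut in cyclic order. *)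
Definition crossing_params : {fset R} :=
  ([fset (val c).1 | c : crossing] `|` [fset (val c).2 | c : crossing])%fset.

Definition cuts : {fset R} := (0 |` crossing_params)%fset.

Definition arc : finType := cuts.

Definition arc_start (a : arc) : R := val a.

Definition arc_stop (a : arc) : R := next (sort <=%R (enum_fset cuts)) (val a).

Definition has_end (a : arc) (e : strand_end) : bool :=
  (if e.2 then arc_start a else arc_stop a) == e.1.

(** * States of a diagram *)

(* Throughout, [true] is the A-resolution and [false] the B-resolution. *)
Definition state := {ffun crossing -> bool}.

Definition numA (s : state) : nat := #|[pred c | s c]|.

Definition numB (s : state) : nat := #|[pred c | ~~ s c]|.

Definition sigma (s : state) : int := (numA s)%:Z - (numB s)%:Z.

(* A rule gives the pairs of ends joined by each resolution of a crossing. *)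
Definition resolution_rule := crossing -> bool -> seq (strand_end * strand_end).

Section States.
Variable rule : resolution_rule.

Definition joined (s : state) : rel arc := fun a b =>
  [exists c, has (fun p => has_end a p.1 && has_end b p.2) (rule c (s c))]
  || [&& 0 \notin crossing_params, has_end a (0, false) & has_end b (0, true)].

Definition loops (s : state) : {set {set arc}} :=
  equivalence_partition
    (connect (fun a b => joined s a b || joined s b a)) [set: arc].

Definition meets (L : {set arc}) (c : crossing) : bool :=
  [exists a in L, has (has_end a) (ends c)].

(* A state together with the set of its loops labelled +. *)
Definition enhanced : finType :=
  {S : state * {set {set arc}} | S.2 \subset loops S.1}.

Definition est (S : enhanced) : state := (val S).1.

Definition plus (S : enhanced) : {set {set arc}} := (val S).2.

Definition tau (S : enhanced) : int :=
  #|plus S|%:Z - #|loops (est S) :\: plus S|%:Z.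

(* The gradings are integers; they take values in rat so that their defining
   formulas involve no rounding. *)
Definition igrad (S : enhanced) : rat := (writhe - sigma (est S))%:Q / 2.

Definition jgrad (S : enhanced) : rat :=
  (3 * writhe - sigma (est S) + 2 * tau S)%:Q / 2.

Definition differ_at (c : crossing) (s t : state) : bool :=
  [&& s c, ~~ t c & [forall d, (d != c) ==> (s d == t d)]].

Definition same_labels_off (c : crossing) (S T : enhanced) : bool :=
  [forall L in loops (est S), ~~ meets L c ==> ((L \in plus S) == (L \in plus T))].

Definition kh_incident : rel enhanced := fun S T =>
  [exists c, differ_at c (est S) (est T) && same_labels_off c S T]
  && (jgrad S == jgrad T).

End States.

(** * Khovanov homology *)

(* The A-smoothing opens the two regions swept by the over-strand as it turns
   counterclockwise to the under-strand: each end of the over-strand is joined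
   to the end of the under-strand lying clockwise from it.  The B-smoothing
   joins it to the other one. *)
Definition kauffman_rule : resolution_rule := fun c r =>
  [seq p <- [seq (e, f) | e <- [:: (over c, true); (over c, false)],
                          f <- [:: (under c, true); (under c, false)]]
     | let d := det2 (end_dir p.1) (end_dir p.2) in if r then d < 0 else 0 < d].

(* Khovanov homology computed from the diagram of K in the xz-plane; by its
   invariance any other diagram of the knot gives an isomorphic result. *)
Definition khovanov (i j : rat) :=
  let C i' := [pred S : enhanced kauffman_rule |
                (igrad S == i') && (jgrad S == j)] in
  homology (@kh_incident kauffman_rule) (C (i - 1)) (C i).

(** * Fronts *)

(* Semicubical cusps are the generic case; only the shape matters here. *)
Definition left_cusp (t : R) : Prop :=
  derive1 (kx K) t = 0 /\ \forall u \near t^', kx K t < kx K u.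

Definition right_cusp (t : R) : Prop :=
  derive1 (kx K) t = 0 /\ \forall u \near t^', kx K u < kx K t.

Definition cusps : set R :=
  [set t | 0 <= t < 1 /\ (left_cusp t \/ right_cusp t)].

Record generic_front : Prop := GenericFront {
  front_cusps : forall t, derive1 (kx K) t = 0 -> left_cusp t \/ right_cusp t;
  finite_cusps : finite_set cusps;
  finite_double_points : finite_set double_points;
  transverse_double_points : forall p, double_points p ->
    det2 (velocity p.1) (velocity p.2) != 0;
  no_triple_points : forall s t u, double_points (s, t) ->
    double_points (t, u) -> False
}.

Definition num_cusps : nat := #|` fset_set cusps|.

Definition tb : rat := writhe%:Q - num_cusps%:Q / 2.

Definition slope (t : R) : R := derive1 (kz K) t / derive1 (kx K) t.

(* For a Legendrian knot the slope dz/dx is y, so the strand of smaller slope is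
   the over-strand defined above. *)
Definition east (t : R) : strand_end := (t, 0 < derive1 (kx K) t).

Definition west (t : R) : strand_end := (t, derive1 (kx K) t < 0).

Definition steeper (c : crossing) : R :=
  let: (s, t) := val c in if slope s < slope t then t else s.

Definition flatter (c : crossing) : R :=
  let: (s, t) := val c in if slope s < slope t then s else t.

Definition NW (c : crossing) := west (flatter c).
Definition SE (c : crossing) := east (flatter c).
Definition SW (c : crossing) := west (steeper c).
Definition NE (c : crossing) := east (steeper c).

Definition legendrian_rule : resolution_rule := fun c r =>
  if r then [:: (NW c, NE c); (SW c, SE c)]
       else [:: (NW c, SW c); (NE c, SE c)].

(* Each B-resolution creates a right cusp and a left cusp. *)
Definition state_cusps (s : state) : nat := (num_cusps + 2 * numB s)%N.

(** * Legendrian Khovanov homology *)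

Definition kgrad (S : enhanced legendrian_rule) : rat :=
  ((state_cusps (est S))%:Z - 2 * left_number%:Z + 2 * tau S)%:Q / 2.

Definition leg_incident : rel (enhanced legendrian_rule) := fun S T =>
  kh_incident S T && (kgrad S == kgrad T).

Definition legendrian_khovanov (i k j : rat) :=
  let C i' := [pred S : enhanced legendrian_rule |
                [&& igrad S == i', kgrad S == k & jgrad S == j]] in
  homology leg_incident (C (i - 1)) (C i).

End Diagram.

(* Main.v *)
(** The A- and B-resolutions of a front crossing, with the cusps forgotten, are
    the A- and B-smoothings of the diagram, so the two complexes have the same
    loops in every state, hence the same generators, and only the k-grading is
    new.  As every crossing is either positive or negative,
    w - sigma = 2 * (numB - l), which makes k = j - tb on every generator: the
    k-grading is determined by j and puts no further constraint on the
    differential. *)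

Require Import Defs.
From mathcomp Require Import all_boot all_order all_algebra.
From mathcomp Require Import all_classical all_reals all_analysis.
From mathcomp Require Import finmap ring.

Import Order.TTheory GRing.Theory Num.Theory.

Local Open Scope ring_scope.

Lemma lmod_isomorphic_refl (F : fieldType) (V : lmodType F) :
  lmod_isomorphic V V.
Proof. by exists idfun; exists idfun. Qed.

Section Loops.
Variables (R : realType) (K : knot R).

Definition rule_homology (rule : resolution_rule K) (i j : rat) :=
  let C i' := [pred S : enhanced rule |
                (igrad S == i') && (jgrad S == j)] in
  homology (@kh_incident R K rule) (C (i - 1)) (C i).

(** The generators, their gradings and the incidence see a rule only through [loops]. Rewriting by
    an equality of functions makes both homologies the same term, with no chain map to build. *)
Lemma rule_homology_eq_loops (r1 r2 : resolution_rule K) (i j : rat) :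
  loops r1 = loops r2 ->
  lmod_isomorphic (rule_homology r1 i j) (rule_homology r2 i j).
Proof.
move=> eq_loops; rewrite /rule_homology /kh_incident /same_labels_off.
rewrite /jgrad /igrad /tau /est /plus /enhanced eq_loops.
exact: lmod_isomorphic_refl.
Qed.

(** Rules list ordered pairs of ends, but loops are classes of a symmetrised relation, so rules are
    compared up to swapping each pair. *)
Definition unoriented (T : Type) (p : T * T -> bool) : T * T -> bool :=
  fun e => p e || p (e.2, e.1).

Lemma eq_loops_rules (r1 r2 : resolution_rule K) :
  (forall c b p, has (unoriented _ p) (r1 c b) = has (unoriented _ p) (r2 c b)) ->
  loops r1 = loops r2.
Proof.
move=> eq_r; apply/funext => s; rewrite /loops.
suff -> : (fun a b => joined r1 s a b || joined r1 s b a) =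
          (fun a b => joined r2 s a b || joined r2 s b a) by [].
have existsU (f g : pred (crossing K)) :
    [exists c, f c] || [exists c, g c] = [exists c, f c || g c].
  apply/orP/existsP => [[/existsP[c fc]|/existsP[c gc]]|[c /orP[fc|gc]]].
  - by exists c; rewrite fc.
  - by exists c; rewrite gc orbT.
  - by left; apply/existsP; exists c.
  - by right; apply/existsP; exists c.
apply/funext => a; apply/funext => b.
(* Regrouping isolates the joins at the base point, which are the same for every rule. *)
rewrite /joined orbACA [in RHS]orbACA !existsU; congr (_ || _).
apply: eq_existsb => c.
have hasE r : has (fun p => has_end a p.1 && has_end b p.2) (r c (s c)) ||
    has (fun p => has_end b p.1 && has_end a p.2) (r c (s c)) =
    has (unoriented _ (fun p => has_end a p.1 && has_end b p.2)) (r c (s c)).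
  rewrite -has_predU; apply: eq_has => p /=.
  by rewrite /unoriented /= [has_end b _ && _]andbC.
by rewrite !hasE eq_r.
Qed.

End Loops.

Section Front.
Variables (R : realType) (K : knot R).
Hypotheses (legK : legendrian K) (genK : generic_front K).

Lemma crossing_double_point (c : crossing K) : double_points K (val c).
Proof.
have := valP c; rewrite in_fset_set; last exact: finite_double_points genK.
exact: set_mem.
Qed.

(** Tangency replaces z' by y x' in both velocities. *)
Lemma det2_velocity (s t : R) :
  det2 (velocity K s) (velocity K t) =
  derive1 (kx K) s * derive1 (kx K) t * (ky K t - ky K s).
Proof. by rewrite /det2 /velocity /= !legK; ring. Qed.

Lemma slopeE t : derive1 (kx K) t != 0 -> slope K t = ky K t.
Proof. by move=> x0; rewrite /slope legK mulfK. Qed.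

(** Transversality makes every factor of [det2_velocity] nonzero: neither strand has a cusp there,
    the values of y differ, and each slope equals y. *)
Lemma crossing_strands (c : crossing K) :
  [/\ derive1 (kx K) (Defs.over c) != 0, derive1 (kx K) (under c) != 0,
      ky K (Defs.over c) < ky K (under c),
      flatter c = Defs.over c & steeper c = under c].
Proof.
have := transverse_double_points genK (crossing_double_point c).
rewrite /Defs.over /under /flatter /steeper; case: (val c) => s t /=.
rewrite det2_velocity !mulf_eq0 !negb_or subr_eq0 => /andP[/andP[xs xt] yst].
rewrite !slopeE //; case: ltP => [|yts] //; split=> //.
by rewrite lt_neqAle yst.
Qed.

Lemma det2_over_under_neq0 (c : crossing K) :
  det2 (velocity K (Defs.over c)) (velocity K (under c)) != 0.
Proof.
have [xo xu yo _ _] := crossing_strands c.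
by rewrite det2_velocity !mulf_neq0 // subr_eq0 gt_eqF.
Qed.

Lemma positive_negative_crossings :
  (#|@positive_crossing R K| + #|@negative_crossing R K| = #|crossing K|)%N.
Proof.
rewrite -(cardC (@positive_crossing R K)); congr (_ + _)%N.
apply: eq_card => c; rewrite !inE /in_mem /= /positive_crossing.
by rewrite /negative_crossing -leNgt lt_neqAle det2_over_under_neq0.
Qed.

(** As y is larger on the under-strand, the determinant of two ends is negative exactly when one
    points east and the other west. Hence A joins opposite sides and B joins equal sides, as on a
    front. *)
Lemma kauffman_legendrian_rule (c : crossing K) b p :
  has (unoriented _ p) (kauffman_rule c b) =
  has (unoriented _ p) (legendrian_rule c b).
Proof.
have [xo xu yo flE stE] := crossing_strands c.
have det2Nl u v : det2 (- u) v = - det2 u v :> R by rewrite /det2 /=; ring.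
have det2Nr u v : det2 u (- v) = - det2 u v :> R by rewrite /det2 /=; ring.
have yuo : 0 < ky K (under c) - ky K (Defs.over c) by rewrite subr_gt0.
rewrite /kauffman_rule /legendrian_rule /NW /NE /SW /SE /west /east flE stE.
rewrite /= /end_dir /= !det2Nl !det2Nr opprK !oppr_gt0 !oppr_lt0.
rewrite det2_velocity pmulr_lgt0 // pmulr_llt0 //.
(* The directions of the two strands give four cases; in each, both rules list the same pairs up to
   order. *)
case: (ltgtP 0 (derive1 (kx K) (Defs.over c))) xo => // xo _;
  [rewrite pmulr_rgt0 // pmulr_rlt0 // | rewrite nmulr_rgt0 // nmulr_rlt0 //];
  case: (ltgtP 0 (derive1 (kx K) (under c))) xu => // xu _;
  case: b; rewrite /unoriented /= !orbF; by do 4?[case: (p _)].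
Qed.

Lemma kauffman_legendrian_loops :
  loops (@kauffman_rule R K) = loops (@legendrian_rule R K).
Proof. by apply: eq_loops_rules => c b p; exact: kauffman_legendrian_rule. Qed.

Lemma kgradE (S : enhanced (@legendrian_rule R K)) :
  kgrad S = jgrad S - tb K.
Proof.
have numAB : (numA (est S) + numB (est S) = #|crossing K|)%N.
  by rewrite -(cardC [pred c | est S c]).
have /(congr1 Posz) := positive_negative_crossings.
(* Solving for the number of positive crossings gives a writhe of
   [numA + numB - 2 * left_number]. *)
rewrite -numAB !PoszD => /(canRL (addrK _)) posE.
rewrite /kgrad /jgrad /tb /state_cusps /writhe /sigma /left_number posE.
rewrite PoszD PoszM.
by field.
Qed.

End Front.

Theorem theorem1p4 (R : realType) (K : knot R) (legK : legendrian K)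
    (genK : generic_front K) (i j : int) :
  lmod_isomorphic (khovanov K i%:Q j%:Q)
    (legendrian_khovanov K i%:Q (j%:Q - tb K) j%:Q).
Proof.
rewrite /legendrian_khovanov.
(* By [kgradE], equal j-gradings, already required by [kh_incident], force equal k-gradings. *)
have -> : @leg_incident R K = @kh_incident R K (@legendrian_rule R K).
  apply/funext => S; apply/funext => T; rewrite /leg_incident !kgradE //.
  by rewrite /kh_incident; case: eqP => [->|]; rewrite ?eqxx ?andbT ?andbF.
have CE i' : [pred S : enhanced (@legendrian_rule R K) |
      [&& igrad S == i', kgrad S == j%:Q - tb K & jgrad S == j%:Q]] =
    [pred S | (igrad S == i') && (jgrad S == j%:Q)] :> pred _.
  apply/funext => S /=; rewrite kgradE //.
  by case: (jgrad S =P _) => [->|]; rewrite ?eqxx ?andbF.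
rewrite /= !CE.
exact/rule_homology_eq_loops/kauffman_legendrian_loops.
Qed.
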